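(* Consider iterated Bayesian linear regression in $\mathbb R^d$ with prior $N(\bar\mu,\bar\sigma^2I_d)$, noise variance $\sigma^2$, and initial distribution $N(\mu_0,\bar\sigma^2I_d)$ of learner $0$. For every constant $c>0$ there is a constant $D_c$ depending only on $c$ such that, for all sufficiently small $\delta,\varepsilon>0$, the sample size sequence $$m_t=D_c\frac{\|\mu_0-\bar\mu\|_2}{\delta}\Bigl(\frac{\sigma}{\bar\sigma}\Bigr)^2t^{1+c}+D_c\,d\log\frac{t+1}{\varepsilon}$$ ensures that $\|\mathbb E\mu_t-\mu_0\|_2\le\delta$ with probability greater than $1-\varepsilon$ (over the random design matrices $X_1,X_2,\dots$).
   Context: Iterated Bayesian linear regression: hypotheses $h\in\mathbb R^d$, common prior $N(\bar\mu,\bar\sigma^2I_d)$. Learner $0$'s distribution is $N(\mu_0,\Sigma_0)$ with $\Sigma_0=\bar\sigma^2I_d$. Learner $t\ge1$ samples $h\sim N(\mu_{t-1},\Sigma_{t-1})$ (the posterior of learner $t-1$), draws an $m_t\times d$ matrix $X_t$ with i.i.d. $N(0,1)$ entries and noise $\phi_t\sim N(0,\sigma^2I_{m_t})$ independently, observes $y_t=X_th+\phi_t$, and forms the posterior $N(\mu_t,\Sigma_t)$ with $\Sigma_t=(\bar\sigma^{-2}I_d+\sigma^{-2}X_t^TX_t)^{-1}$ and $\mu_t=\Sigma_t(\bar\sigma^{-2}\bar\mu+\sigma^{-2}X_t^Ty_t)$. Here $\mathbb E\mu_t$ denotes the expectation of $\mu_t$ over the sampled hypotheses and noises, conditional on $X_1,\dots,X_t$;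 thus $\mathbb E\mu_t$ is a random vector depending on $X_1,\dots,X_t$, satisfying $\mathbb E\mu_t=(I_d+M_t)^{-1}(\bar\mu+M_t\mathbb E\mu_{t-1})$ with $M_t=(\bar\sigma/\sigma)^2X_t^TX_t$. The logarithm is natural. *)

(* Defs.v *)
From HB Require Import structures.
From mathcomp Require Import all_boot all_order all_algebra.
From mathcomp Require Import all_classical all_reals all_analysis.
Set Implicit Arguments. Unset Strict Implicit. Unset Printing Implicit Defensive.
Import Order.TTheory GRing.Theory Num.Theory.
Local Open Scope classical_set_scope.
Local Open Scope ring_scope.

Definition norm2 {R : realType} {d : nat} (v : 'cV[R]_d) : R :=
  Num.sqrt (\sum_(i < d) v i ord0 ^+ 2).

(* Index of a Gaussian design entry: (t, row i, column j). *)
Definition idx := (nat * nat * nat)%type.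

Definition mutually_independent {R : realType} {d : measure_display}
  {T : measurableType d} (P : probability T R) (X : idx -> T -> R) : Prop :=
  forall (s : seq idx) (B : idx -> set R), uniq s ->
    (forall k, measurable (B k)) ->
    P (\bigcap_(k in [set k | k \in s]) (X k @^-1` B k)) =
    (\prod_(k <- s) P (X k @^-1` B k))%E.

Definition std_normal_rv {R : realType} {d : measure_display}
  {T : measurableType d} (P : probability T R) (Y : T -> R) : Prop :=
  measurable_fun setT Y /\
  forall B : set R, measurable B -> P (Y @^-1` B) = normal_prob 0 1 B.

Definition design {R : realType} {d0 : measure_display} {T : measurableType d0}
  (X : idx -> T -> R) (t m d : nat) (w : T) : 'M[R]_(m, d) :=
  \matrix_(i < m, j < d) X (t, nat_of_ord i, nat_of_ord j) w.

(* E mu_t, conditional on X_1..X_t, via the recursion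
   E mu_t = (I + M_t)^{-1} (mubar + M_t E mu_{t-1}),
   M_t = (sbar/sigma)^2 X_t^T X_t, E mu_0 = mu_0. *)
Fixpoint Emu {R : realType} {d0 : measure_display} {T : measurableType d0}
  (d : nat) (sbar sigma : R) (mubar mu0 : 'cV[R]_d) (m : nat -> nat)
  (X : idx -> T -> R) (t : nat) (w : T) : 'cV[R]_d :=
  match t with
  | 0 => mu0
  | t'.+1 =>
      let Xt := design X t'.+1 (m t'.+1) d w in
      let Mt := ((sbar / sigma) ^+ 2) *: (Xt^T *m Xt) in
      invmx (1%:M + Mt) *m (mubar + Mt *m Emu sbar sigma mubar mu0 m X t' w)
  end.

Definition sample_size {R : realType} (Dc c delta eps sbar sigma : R) (d : nat)
  (dist : R) (t : nat) : nat :=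
  `| Num.ceil (Dc * dist / delta * (sigma / sbar) ^+ 2 * powR (t%:R) (1 + c)
               + Dc * d%:R * ln ((t%:R + 1) / eps)) |%N.

(* Main.v *)
(* Write e_t = E mu_t - mu0 and b = mubar - mu0. The recursion becomes
   e_t = (I + M_t)^-1 (b + M_t e_(t-1)); since M_t (I + M_t)^-1 is a contraction,
   |e_t| <= |b| / (1 + lambda_t) + |e_(t-1)| as soon as M_t >= lambda_t I, so it
   suffices that X_t^T X_t >= kappa m_t I for all t with an absolute constant kappa:
   then lambda_t is of order D_c |b| t^(1+c) / delta and sum_t t^-(1+c) <= 1 + 1/c.

   For a fixed vector g, E exp (- a |X g|^2) = (1 + 2 a |g|^2)^(-m/2), and Markov's
   inequality makes |X g|^2 < kappa' m exponentially unlikely; |X|_F^2 = O(d m) fails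
   with probability at most e^-m as well. A grid of the cube, fine enough in terms of
   d, transfers the lower bound from grid points to all v. The size C of the grid
   depends on d only and is absorbed by eps < 1 / C: design t fails with
   probability at most C e^(-m_t) <= C eps^2 / (t + 1)^2, which sums to at most
   C eps^2 < eps. *)
Require Import Defs.
From HB Require Import structures.
From mathcomp Require Import all_boot all_order all_algebra.
From mathcomp Require Import all_classical all_reals all_analysis.
From mathcomp Require Import measurable_realfun ring lra.
Import Order.TTheory GRing.Theory Num.Theory.
Local Open Scope classical_set_scope.
Local Open Scope ring_scope.

(** * Gaussian integrals *)

(** The Radon-Nikodym derivative and the density have equal integrals over every measurable set, so
    they agree almost everywhere. *)
Lemma ge0_integral_normal_prob {R : realType} (m s : R) (f : R -> \bar R) :
  measurable_fun setT f -> (forall x, 0 <= f x)%E ->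
  (\int[normal_prob m s]_x f x =
   \int[lebesgue_measure]_x (f x * (normal_pdf m s x)%:E))%E.
Proof.
move=> mf f0.
have dom := normal_prob_dominates m s.
rewrite -(Radon_Nikodym_SigmaFinite.change_of_variables dom) //.
have mpdf : measurable_fun setT (EFin \o normal_pdf m s).
  by apply/measurable_EFinP; exact: measurable_normal_pdf.
have iRN := Radon_Nikodym_SigmaFinite.f_integrable dom.
apply: ae_eq_integral => //.
- by apply: emeasurable_funM => //; exact: (measurable_int _ iRN).
- exact: emeasurable_funM.
- apply: ae_eqe_mul2l; apply: integral_ae_eq => //= E _ mE.
  by rewrite -Radon_Nikodym_SigmaFinite.f_integral.
Qed.

Lemma gaussian_square_completion {F : realFieldType} (a L v x q : F) :
  q != 0 -> q = 1 + 2 * a * v ^+ 2 ->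
  - a * (L + v * x) ^+ 2 + - x ^+ 2 / 2 =
  - (a / q) * L ^+ 2 + - (x - - (2 * a * L * v) / q) ^+ 2 / (q^-1 * 2).
Proof.
move=> q0 qE.
(* The exponent is [- (q x^2 + 4 a L v x + 2 a L^2) / 2]; multiplying by [q] completes the square
   without dividing by [a] or [v]. *)
transitivity (- (2 * a * L ^+ 2 + (q * x + 2 * a * L * v) ^+ 2) / (2 * q));
  last by field.
have -> : 2 * a * L ^+ 2 + (q * x + 2 * a * L * v) ^+ 2 =
    q * (2 * a * (L + v * x) ^+ 2 + x ^+ 2) by rewrite qE; ring.
by field.
Qed.

(** The tilted density is a multiple of the normal density of variance [1 / q], so its integral can
    be read off. Only [q > 0] is assumed: [gaussian_square_mgf] takes [a = - 1/4]. *)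
Lemma gaussian_transform_pdf {R : realType} (a L v x : R) : 0 < 1 + 2 * a * v ^+ 2 ->
  let q := 1 + 2 * a * v ^+ 2 in
  expR (- a * (L + v * x) ^+ 2) * normal_pdf 0 1 x =
  (Num.sqrt q)^-1 * expR (- (a / q) * L ^+ 2) *
    normal_pdf (- (2 * a * L * v) / q) (Num.sqrt q)^-1 x.
Proof.
move=> q0 q; rewrite -/q in q0.
have sq0 : 0 < Num.sqrt q by rewrite sqrtr_gt0.
have qn0 : q != 0 by rewrite gt_eqF.
rewrite !normal_pdfE ?oner_neq0 ?invr_eq0 ?gt_eqF//.
rewrite /normal_peak /normal_fun.
rewrite exprVn sqr_sqrtr ?ltW// expr1n mul1r subr0.
have -> : Num.sqrt (q^-1 * pi *+ 2) = (Num.sqrt q)^-1 * Num.sqrt (pi *+ 2).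
  by rewrite -mulrnAr sqrtrM ?invr_ge0 ?ltW// sqrtrV ?ltW.
rewrite invfM invrK.
have -> : forall u p E1 E2 : R, u != 0 -> u^-1 * E1 * (u * p * E2) = p * (E1 * E2).
  by move=> u p E1 E2 u0; field.
  rewrite mulrCA -!expRD; congr (_ * expR _).
  rewrite -[q^-1 *+ 2]mulr_natr.
  exact: gaussian_square_completion.
by rewrite gt_eqF.
Qed.

Lemma integral_gaussian_transform {R : realType} (a L v : R) : 0 < 1 + 2 * a * v ^+ 2 ->
  let q := 1 + 2 * a * v ^+ 2 in
  (\int[normal_prob 0 1]_x (expR (- a * (L + v * x) ^+ 2))%:E =
   ((Num.sqrt q)^-1 * expR (- (a / q) * L ^+ 2))%:E)%E.
Proof.
move=> q0 q; rewrite ge0_integral_normal_prob; last 2 first.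
- apply/measurable_EFinP; apply: measurableT_comp => //.
  apply: measurable_funM => //; apply: measurable_funX.
  by apply: measurable_funD => //; apply: measurable_funM.
- by move=> x; rewrite lee_fin expR_ge0.
under eq_integral do rewrite -EFinM gaussian_transform_pdf// EFinM.
rewrite ge0_integralZl// ?integral_normal_pdf ?mule1//.
- by apply/measurable_EFinP; exact: measurable_normal_pdf.
- by move=> x _; rewrite lee_fin normal_pdf_ge0.
Qed.

(** * Independence from the past *)

(** The law of [(Z, Y)] agrees with a product measure on rectangles, hence equals it, and Tonelli's
    theorem applies. *)
Lemma ge0_integral_indep {R : realType} {dT dU dV : measure_display}
  {T : measurableType dT} {U : measurableType dU} {V : measurableType dV}
  (P : probability T R) (nu : probability V R) (Z : T -> U) (Y : T -> V)
  (f : U * V -> \bar R) :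
  measurable_fun setT Z -> measurable_fun setT Y ->
  (forall A B, measurable A -> measurable B ->
    P (Z @^-1` A `&` Y @^-1` B) = (P (Z @^-1` A) * nu B)%E) ->
  measurable_fun setT f -> (forall x, 0 <= f x)%E ->
  (\int[P]_w f (Z w, Y w) = \int[P]_w \int[nu]_y f (Z w, y))%E.
Proof.
move=> mZ mY ind mf f0.
pose Z' : {mfun T >-> U} := HB.pack Z (isMeasurableFun.Build _ _ _ _ _ mZ).
have mZY : measurable_fun setT (fun w => (Z w, Y w)) by exact: measurable_fun_pair.
pose ZY : {mfun T >-> (U * V)%type} :=
  HB.pack (fun w => (Z w, Y w)) (isMeasurableFun.Build _ _ _ _ _ mZY).
rewrite -[LHS](ge0_integral_distribution (P := P) ZY mf f0).
rewrite -(ge0_integral_distribution (P := P) Z' (f := fun u => \int[nu]_y f (u, y))%E).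
- rewrite -(fubini_tonelli1 (m1 := distribution P Z') (m2 := nu))//.
  apply: eq_measure_integral => A mA _; apply/esym.
  exact: product_measure_unique.
- exact: measurable_fun_fubini_tonelli_F.
- by move=> u; exact: integral_ge0.
Qed.

Section peeling.
Context {R : realType} {dT : measure_display} {T : measurableType dT}.
Variables (P : probability T R) (X : idx -> T -> R).

Definition cylinders (s : seq idx) : set (set T) :=
  [set A | exists2 B : idx -> set R, (forall k, measurable (B k)) &
    A = \bigcap_(k in [set` s]) (X k @^-1` B k)].

(** A copy of [T] with the sigma-algebra generated by the coordinates in [s]: measurability out of
    [past s] expresses dependence on these coordinates alone. *)
Definition past (s : seq idx) := g_sigma_algebraType (cylinders s).

Lemma setI_closed_cylinders s : setI_closed (cylinders s).
Proof.
move=> _ _ [B mB ->] [C mC ->]; exists (fun k => B k `&` C k).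
  by move=> k; exact: measurableI.
by rewrite -bigcapI.
Qed.

Lemma past_measurable_coord s k : k \in s ->
  measurable_fun setT (X k : past s -> R).
Proof.
move=> ks _ A mA; rewrite setTI; apply: sub_sigma_algebra.
exists (fun j => if j == k then A else setT); first by move=> j; case: ifP.
apply/seteqP; split=> w /=.
  by move=> Aw j js /=; case: eqP => // ->.
by move=> /(_ k ks) /=; rewrite eqxx.
Qed.

Hypothesis mX : forall k, measurable_fun setT (X k).
Hypothesis indX : mutually_independent P X.

Lemma measurable_past s (A : set (past s)) : measurable A ->
  measurable (A : set T).
Proof.
suff: <<s cylinders s >> `<=` @measurable _ T by apply.
apply: smallest_sub; first exact: sigma_algebra_measurable.
move=> _ [B mB ->]; apply: fin_bigcap_measurable => //.
by move=> k _; rewrite -[_ @^-1` _]setTI; exact: mX.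
Qed.

(** As functions of [A], both sides are finite measures on [past s]. They agree on cylinders, which
    form a generating pi-system, hence everywhere. *)
Lemma past_indep s k (A : set (past s)) (B : set R) :
  uniq (k :: s) -> measurable A -> measurable B ->
  P ((A : set T) `&` X k @^-1` B) = (P (A : set T) * P (X k @^-1` B))%E.
Proof.
move=> us mA mB.
have mkB : measurable (X k @^-1` B) by rewrite -[_ @^-1` _]setTI; exact: mX.
pose r : {nonneg R} := NngNum (fine_ge0 (measure_ge0 P (X k @^-1` B))).
have rE : (r%:num%:E)%E = P (X k @^-1` B).
  by apply: fineK; exact: fin_num_measure.
rewrite muleC -rE.
have mid : measurable_fun setT (id : T -> past s).
  by move=> _ C mC; rewrite setTI; exact: (measurable_past s C mC).
pose idm : {mfun T >-> past s} := HB.pack (id : T -> past s)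
  (isMeasurableFun.Build _ _ _ _ _ mid).
pose m1 : {measure set (past s) -> \bar R} :=
  pushforward (mrestr P mkB) idm.
pose m2 : {measure set (past s) -> \bar R} := mscale r (distribution P idm).
suff: m1 mid A = m2 A by [].
apply: (@measure_unique _ R (past s) (cylinders s) (fun=> setT) _ _ _ _ (m1 mid) m2) => //.
- exact: setI_closed_cylinders.
- by move=> _; exists (fun=> setT) => //; rewrite bigcapT.
- by rewrite bigcup_const.
- move=> _ [C mC ->].
  rewrite /m1 /m2 /= /mscale /distribution /pushforward /mrestr /= rE muleC.
  (* The intersection is again a cylinder, over [k :: s], to which mutual independence applies. *)
  have -> : \bigcap_(j in [set` s]) X j @^-1` C j `&` X k @^-1` B =
      \bigcap_(j in [set` k :: s]) X j @^-1` (if j == k then B else C j).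
    move: us => /= /andP[ks _].
    apply/seteqP; split=> w /=.
      move=> [sw kw] j /=; rewrite inE; case: eqP => [->//|_ /= js]; exact: sw.
    move=> H; split.
      move=> j js; have := H j; rewrite /= inE js orbT => /(_ isT).
      by case: eqP => // jk; rewrite -jk js in ks.
    by have := H k; rewrite /= inE eqxx => /(_ isT).
  rewrite (indX (k :: s) (fun j => if j == k then B else C j))//; last first.
    by move=> j; case: ifP.
  move: us => /= /andP[ks us].
  rewrite big_cons eqxx muleC (indX s C)//; congr (_ * _)%E.
  apply: eq_big_seq => j js; case: eqP => // jk.
  by rewrite -jk js in ks.
- move=> _; rewrite /m1 /= /pushforward /mrestr /=.
  by rewrite (le_lt_trans (probability_le1 _ _)) ?ltry// setTI.
Qed.

End peeling.

(** * Integrating out Gaussian coordinates one at a time *)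

Section gaussian_peeling.
Context {R : realType} {dT : measure_display} {T : measurableType dT}.
Variables (P : probability T R) (X : idx -> T -> R).
Hypothesis gaussX : forall k, std_normal_rv P (X k).
Hypothesis indX : mutually_independent P X.

Definition adapted (s : seq idx) (f : T -> R) :=
  measurable_fun setT (f : past X s -> R).

Lemma adapted_sub (s s' : seq idx) f : {subset s <= s'} -> adapted s f -> adapted s' f.
Proof.
move=> ss' af _ A mA; have := af measurableT A mA; rewrite !setTI.
suff: <<s cylinders X s >> `<=` <<s cylinders X s' >> by apply.
apply: smallest_sub; first exact: smallest_sigma_algebra.
move=> _ [B mB ->]; apply: sub_sigma_algebra.
exists (fun k => if k \in s then B k else setT); first by move=> k; case: ifP.
apply/seteqP; split=> w /= H k ks; last first.
  by have := H k (ss' _ ks); rewrite /= ks.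
by rewrite /=; case: ifPn => // /H.
Qed.

Lemma adapted_coord s k : k \in s -> adapted s (X k).
Proof. exact: past_measurable_coord. Qed.

Lemma adapted_measurable s f : adapted s f -> measurable_fun setT f.
Proof.
move=> af _ A mA; have := af measurableT A mA; rewrite !setTI.
by apply: measurable_past => k; case: (gaussX k).
Qed.

(* Integrating out one Gaussian coordinate keeps the exponent a multiple of the
   square of the remaining linear form: a becomes a / (1 + 2 a v^2). *)
Lemma gaussian_peel s k (G L : T -> R) (a v : R) :
  uniq (k :: s) -> adapted s G -> adapted s L -> (forall w, 0 <= G w) ->
  0 < 1 + 2 * a * v ^+ 2 ->
  let q := 1 + 2 * a * v ^+ 2 in
  (\int[P]_w (G w * expR (- a * (L w + v * X k w) ^+ 2))%:E =
   ((Num.sqrt q)^-1)%:E * \int[P]_w (G w * expR (- (a / q) * L w ^+ 2))%:E)%E.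
Proof.
move=> us aG aL G0 q0 q.
have mX j : measurable_fun setT (X j) by case: (gaussX j).
pose f := fun z : past X s * R =>
  (G z.1 * expR (- a * (L z.1 + v * z.2) ^+ 2))%:E.
have mG : measurable_fun setT (fun z : past X s * R => G z.1).
  by apply: (@measurableT_comp _ _ _ _ _ _ (G : past X s -> R)).
have mL : measurable_fun setT (fun z : past X s * R => L z.1).
  by apply: (@measurableT_comp _ _ _ _ _ _ (L : past X s -> R)).
have mf : measurable_fun setT f.
  apply/measurable_EFinP; apply: measurable_funM => //.
  apply: measurableT_comp => //; apply: measurable_funM => //.
  by apply: measurable_funX; apply: measurable_funD => //; apply: measurable_funM.
have f0 z : (0 <= f z)%E by rewrite lee_fin mulr_ge0 ?expR_ge0.
have mid : measurable_fun setT (id : T -> past X s).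
  by move=> _ C mC; rewrite setTI; exact: (measurable_past X mX s C mC).
rewrite (_ : (\int[P]_w _)%E = \int[P]_w f (id w, X k w))%E//.
rewrite (ge0_integral_indep P (normal_prob 0 1) (id : T -> past X s) (X k))//; last first.
  move=> C D mC mD; have := past_indep P X mX indX s k C D us mC mD.
  by have [_ ->] := gaussX k.
  exact: mX.
rewrite -ge0_integralZl//; last first.
- by move=> w _; rewrite lee_fin mulr_ge0 ?expR_ge0.
- apply/measurable_EFinP; apply: measurable_funM; first exact: adapted_measurable aG.
  apply: measurableT_comp => //; apply: measurable_funM => //.
  by apply: measurable_funX; exact: adapted_measurable aL.
apply: eq_integral => w _; rewrite /f /=.
under eq_integral do rewrite EFinM.
rewrite ge0_integralZl//; last first.
- by rewrite lee_fin.
- apply/measurable_EFinP; apply: measurableT_comp => //.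
  apply: measurable_funM => //; apply: measurable_funX.
  by apply: measurable_funD => //; apply: measurable_funM.
by rewrite integral_gaussian_transform// -!EFinM mulrCA.
Qed.

Lemma adapted_lincomb (s ks : seq idx) (c : idx -> R) : {subset ks <= s} ->
  adapted s (fun w => \sum_(k <- ks) c k * X k w).
Proof.
move=> kss; rewrite /adapted.
(* [measurable_sum] asks for every summand to be measurable, so terms with index outside [s] get the
   dummy value 0. *)
rewrite (_ : (fun w => _) =
  (fun w => \sum_(k <- ks) if k \in s then c k * X k w else 0)); last first.
  by apply/funext => w; apply: eq_big_seq => k /kss ->.
apply: measurable_sum => k; case: (boolP (k \in s)) => [ks0|_]; last exact: measurable_cst.
by apply: measurable_funM => //; exact: adapted_coord.
Qed.

(** Peeling [k] leaves the exponent [a / q], and the factors combine because [q (1 + 2 (a / q) S) =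
    1 + 2 a (c_k^2 + S)], where [S] sums the remaining squared coefficients. *)
Lemma gaussian_peel_lincomb (s ks : seq idx) (c : idx -> R) (G : T -> R) (a : R) :
  uniq (ks ++ s) -> adapted s G -> (forall w, 0 <= G w) -> 0 <= a ->
  (\int[P]_w (G w * expR (- a * (\sum_(k <- ks) c k * X k w) ^+ 2))%:E =
   ((Num.sqrt (1 + 2 * a * \sum_(k <- ks) c k ^+ 2))^-1)%:E *
     \int[P]_w (G w)%:E)%E.
Proof.
move=> + aG G0; elim: ks a => [|k ks IH] a.
  move=> _ _; rewrite big_nil mulr0 addr0 sqrtr1 invr1 mul1e.
  apply: eq_integral => w _.
  by rewrite big_nil expr0n/= mulr0 expR0 mulr1.
rewrite cat_cons => us a0.
have q0 : 0 < 1 + 2 * a * c k ^+ 2.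
  by rewrite ltr_pwDl// mulr_ge0 ?sqr_ge0// mulr_ge0.
under eq_integral do rewrite big_cons addrC.
rewrite (gaussian_peel (ks ++ s) k G
  (fun w => \sum_(j <- ks) c j * X j w) a (c k))//; last 2 first.
- by apply: adapted_sub aG => j js; rewrite mem_cat js orbT.
- by apply: adapted_lincomb => j js; rewrite mem_cat js.
rewrite IH; last 2 first.
- by move: us => /= /andP[].
- by rewrite divr_ge0// ltW.
rewrite muleA -EFinM -invfM -sqrtrM ?ltW// big_cons; congr (_^-1%:E * _)%E.
congr Num.sqrt; rewrite mulrDr mulr1 mulrDr addrA; congr (_ + _).
by field; rewrite gt_eqF.
Qed.

(** Peeling with [L = 0], [v = 1] and [a = - 1/4] gives [q = 1/2], that is, a factor [sqrt 2] per
    coordinate. *)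
Lemma gaussian_square_mgf ks : uniq ks ->
  (\int[P]_w (expR (4^-1 * \sum_(k <- ks) X k w ^+ 2))%:E =
   (Num.sqrt 2 ^+ size ks)%:E)%E.
Proof.
elim: ks => [|k ks IH] us.
  under eq_integral do rewrite big_nil mulr0 expR0.
  by rewrite integral_cst//= mul1e probability_setT.
under eq_integral do rewrite big_cons mulrDr expRD mulrC.
rewrite (_ : (\int[P]_w _)%E = \int[P]_w (expR (4^-1 * \sum_(j <- ks) X j w ^+ 2) *
    expR (- (- 4^-1) * (cst 0 w + 1 * X k w) ^+ 2))%:E)%E; last first.
  by apply: eq_integral => w _; rewrite /cst /= opprK add0r mul1r.
have E2 : 1 + 2 * (- 4^-1) * 1 ^+ 2 = 2^-1 :> R by field.
rewrite (gaussian_peel ks k)//; last 3 first.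
- apply: measurableT_comp => //; apply: measurable_funM => //.
  rewrite (_ : (fun w => _) =
    (fun w => \sum_(j <- ks) if j \in ks then X j w ^+ 2 else 0)); last first.
    by apply/funext => w; apply: eq_big_seq => j ->.
  apply: measurable_sum => j; case: (boolP (j \in ks)) => [js|_]; last exact: measurable_cst.
  by apply: measurable_funX; exact: adapted_coord.
- exact: measurable_cst.
- by rewrite E2.
under eq_integral do rewrite expr0n/= mulr0 expR0 mulr1.
rewrite IH; last by case/andP: us.
by rewrite E2 sqrtrV// invrK -EFinM exprS.
Qed.

End gaussian_peeling.

(** * Gaussian design matrices *)

Definition sqnorm {F : pzRingType} {n : nat} (v : 'cV[F]_n) : F :=
  \sum_(i < n) v i ord0 ^+ 2.

Definition sqfrob {F : pzRingType} {m n : nat} (A : 'M[F]_(m, n)) : F :=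
  \sum_(i < m) \sum_(j < n) A i j ^+ 2.

Lemma probability_le_integral {R : realType} {dT : measure_display}
  {T : measurableType dT} (P : probability T R) (A : set T) (f : T -> R) :
  measurable A -> measurable_fun setT f -> (forall w, 0 <= f w) ->
  (forall w, A w -> 1 <= f w) -> (P A <= \int[P]_w (f w)%:E)%E.
Proof.
move=> mA mf f0 f1; rewrite -[A in P A]setIT -integral_indic//.
apply: ge0_le_integral => //.
- by apply/measurable_EFinP; exact: measurable_indic.
- by apply/measurable_EFinP.
- move=> w _; rewrite lee_fin indicE; case: (boolP (w \in A)) => [|_].
    by rewrite inE => /f1.
  exact: f0.
Qed.

Section design_bounds.
Context {R : realType} {dT : measure_display} {T : measurableType dT}.
Variables (P : probability T R) (X : idx -> T -> R).
Hypothesis gaussX : forall k, std_normal_rv P (X k).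
Hypothesis indX : mutually_independent P X.

Definition row_keys (t i d : nat) : seq idx :=
  [seq (t, i, nat_of_ord j) | j <- index_enum 'I_d].

(** Listed row by row, so that passing from [m] to [m.+1] appends one row and inductions on [m] can
    peel the last row. *)
Definition design_keys (t m d : nat) : seq idx :=
  flatten [seq row_keys t i d | i <- iota 0 m].

Lemma mem_row_keys t i d k : (k \in row_keys t i d) -> k.1 = (t, i).
Proof. by move=> /mapP[j _ ->]. Qed.

Lemma uniq_row_keys t i d : uniq (row_keys t i d).
Proof. by rewrite map_inj_uniq ?index_enum_uniq// => j j' [] /val_inj. Qed.

Lemma design_keysS t m d : design_keys t m.+1 d = design_keys t m d ++ row_keys t m d.
Proof.
by rewrite /design_keys -[m.+1]addn1 iotaD map_cat flatten_cat /= cats0.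
Qed.

Lemma uniq_design_keysS t m d : uniq (design_keys t m d) ->
  uniq (row_keys t m d ++ design_keys t m d).
Proof.
move=> um; rewrite cat_uniq uniq_row_keys um andbT.
apply/hasPn => k /flattenP[_ /mapP[i + ->] /mem_row_keys ki].
rewrite mem_iota add0n => /= im; apply/negP => /mem_row_keys.
by rewrite ki => -[] mi; rewrite mi ltnn in im.
Qed.

Lemma uniq_design_keys t m d : uniq (design_keys t m d).
Proof.
elim: m => // m IH; rewrite design_keysS.
by have := uniq_design_keysS _ _ _ IH; rewrite !cat_uniq has_sym => /and3P[-> -> ->].
Qed.

Lemma size_design_keys t m d : size (design_keys t m d) = (m * d)%N.
Proof.
elim: m => // m IH; rewrite design_keysS size_cat IH size_map.
by rewrite mulSn addnC; congr addn; rewrite -sum1_size sum1_card card_ord.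
Qed.

Lemma sqnorm_design t m d (g : 'cV[R]_d) w :
  sqnorm (design X t m d w *m g) =
  \sum_(i < m) (\sum_(j < d) g j ord0 * X (t, nat_of_ord i, nat_of_ord j) w) ^+ 2.
Proof.
apply: eq_bigr => i _; congr (_ ^+ 2); rewrite mxE; apply: eq_bigr => j _.
by rewrite mxE mulrC.
Qed.

Lemma sqfrob_design t m d w :
  sqfrob (design X t m d w) = \sum_(k <- design_keys t m d) X k w ^+ 2.
Proof.
rewrite /sqfrob; elim: m => [|m IH]; first by rewrite big_ord0 big_nil.
rewrite big_ord_recr design_keysS big_cat /=; congr (_ + _).
  rewrite -IH; apply: eq_bigr => i _; apply: eq_bigr => j _.
  by rewrite !mxE.
by rewrite big_map; apply: eq_bigr => j _; rewrite !mxE.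
Qed.

(** Each row contributes one squared linear form in fresh coordinates, with coefficients [g]. *)
Lemma gaussian_design_mgf t m d (g : 'cV[R]_d) (a : R) : 0 <= a ->
  (\int[P]_w (expR (- a * sqnorm (design X t m d w *m g)))%:E =
   ((Num.sqrt (1 + 2 * a * sqnorm g))^-1 ^+ m)%:E)%E.
Proof.
move=> a0.
under eq_integral do rewrite sqnorm_design.
(* Extends [g] to all keys by reading the column index; the default 0 is never met on [row_keys]. *)
pose c (k : idx) : R := if insub k.2 is Some j then g j ord0 else 0.
have rowE i w : \sum_(j < d) g j ord0 * X (t, i, nat_of_ord j) w =
    \sum_(k <- row_keys t i d) c k * X k w.
  by rewrite big_map; apply: eq_bigr => j _; rewrite /c /= valK.
have sqE i : sqnorm g = \sum_(k <- row_keys t i d) c k ^+ 2.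
  by rewrite big_map; apply: eq_bigr => j _; rewrite /c /= valK.
elim: m => [|m IH].
  under eq_integral do rewrite big_ord0 mulr0 expR0.
  by rewrite integral_cst//= mul1e probability_setT.
under eq_integral do rewrite big_ord_recr/= mulrDr expRD (rowE m).
rewrite (gaussian_peel_lincomb P X gaussX indX (design_keys t m d)
  (row_keys t m d) c (fun w => expR (- a * \sum_(i < m)
    (\sum_(j < d) g j ord0 * X (t, nat_of_ord i, nat_of_ord j) w) ^+ 2)) a)//.
- by rewrite IH -EFinM -sqE exprS.
- exact: uniq_design_keysS _ _ _ (uniq_design_keys t m d).
- apply: measurableT_comp => //; apply: measurable_funM => //.
  apply: measurable_sum => i; apply: measurable_funX.
  apply: measurable_sum => j; apply: measurable_funM => //.
  apply: adapted_coord; apply/flattenP; exists (row_keys t i d).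
    by apply: (map_f (fun i => row_keys t i d)); rewrite mem_iota add0n ltn_ord.
  by apply: (map_f (fun j : 'I_d => (t, nat_of_ord i, nat_of_ord j))); rewrite mem_index_enum.
Qed.

Let mX k : measurable_fun setT (X k).
Proof. by case: (gaussX k). Qed.

Lemma measurable_sqnorm_design t m d (g : 'cV[R]_d) :
  measurable_fun setT (fun w => sqnorm (design X t m d w *m g)).
Proof.
under eq_fun do rewrite sqnorm_design.
apply: measurable_sum => i; apply: measurable_funX.
by apply: measurable_sum => j; apply: measurable_funM.
Qed.

Lemma measurable_sqfrob_design t m d :
  measurable_fun setT (fun w => sqfrob (design X t m d w)).
Proof.
under eq_fun do rewrite sqfrob_design.
by apply: measurable_sum => k; apply: measurable_funX.
Qed.

(* The constant a = 2 e^4 makes sqrt (1 + 2 a |g|^2) at least e^2 for |g|^2 >= 1/4. *)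
Lemma sqnorm_design_small t m d (g : 'cV[R]_d) : 4^-1 <= sqnorm g ->
  (P [set w | sqnorm (design X t m d w *m g) <= m%:R / (2 * expR 4)]%R
    <= (expR (- m%:R))%:E)%E.
Proof.
move=> g4; pose a : R := 2 * expR 4.
have a0 : 0 < a by rewrite mulr_gt0 ?expR_gt0.
have mS : measurable [set w | sqnorm (design X t m d w *m g) <= m%:R / a].
  rewrite -[X in measurable X]setTI; apply: measurable_fun_ler => //.
  exact: measurable_sqnorm_design.
(* Chernoff bound: the majorant is at least 1 on the event and has expectation at most
   [e^m (e^2)^(-m) = e^(-m)]. *)
apply: (le_trans (probability_le_integral P _
  (fun w => expR m%:R * expR (- a * sqnorm (design X t m d w *m g))) mS _ _ _)).
- apply: measurable_funM => //; apply: measurableT_comp => //.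
  by apply: measurable_funM => //; exact: measurable_sqnorm_design.
- by move=> w; rewrite mulr_ge0 ?expR_ge0.
- move=> w /= gw; rewrite -expRD -[leLHS]expR0 ler_expR mulNr subr_ge0.
  by rewrite mulrC -ler_pdivlMr.
under eq_integral do rewrite EFinM.
rewrite ge0_integralZl//; last first.
- apply/measurable_EFinP; apply: measurableT_comp => //.
  by apply: measurable_funM => //; exact: measurable_sqnorm_design.
rewrite (gaussian_design_mgf _ _ _ _ _ (ltW a0)) -EFinM lee_fin.
have qe : expR 2 <= Num.sqrt (1 + 2 * a * sqnorm g).
  rewrite -[leLHS]ger0_norm ?expR_ge0// -sqrtr_sqr ler_sqrt; last first.
    by rewrite addr_ge0// !mulr_ge0 ?expR_ge0// (le_trans _ g4).
  rewrite -expRM_natl.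
  have -> : 2 * 2 = 4 :> R by ring.
  have := expR_gt0 (4 : R); rewrite /a; nra.
apply: (@le_trans _ _ (expR m%:R * (expR 2)^-1 ^+ m)).
  rewrite ler_pM2l ?expR_gt0// lerXn2r ?nnegrE ?invr_ge0 ?expR_ge0 ?sqrtr_ge0//.
  by rewrite lef_pV2 ?posrE ?expR_gt0// (lt_le_trans _ qe) ?expR_gt0.
by rewrite -expRN -expRM_natl -expRD ler_expR -mulr_natl; lra.
Qed.

(** Chernoff bound with exponent [1/4]: the generating function is [sqrt 2 ^ (m d) <= e^(m d)], and
    the threshold supplies [e^(- (1 + d) m)]. *)
Lemma sqfrob_design_large t m d :
  (P [set w | (4 + 4 * d%:R) * m%:R <= sqfrob (design X t m d w)]%R
    <= (expR (- m%:R))%:E)%E.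
Proof.
have mS : measurable [set w | (4 + 4 * d%:R) * m%:R <= sqfrob (design X t m d w)].
  rewrite -[X in measurable X]setTI; apply: measurable_fun_ler => //.
  exact: measurable_sqfrob_design.
apply: (le_trans (probability_le_integral P _
  (fun w => expR (- ((1 + d%:R) * m%:R)) * expR (4^-1 * sqfrob (design X t m d w))) mS _ _ _)).
- apply: measurable_funM => //; apply: measurableT_comp => //.
  by apply: measurable_funM => //; exact: measurable_sqfrob_design.
- by move=> w; rewrite mulr_ge0 ?expR_ge0.
- by move=> w /= gw; rewrite -expRD -[leLHS]expR0 ler_expR; lra.
under eq_integral do rewrite EFinM.
rewrite ge0_integralZl//; last first.
- apply/measurable_EFinP; apply: measurableT_comp => //.
  by apply: measurable_funM => //; exact: measurable_sqfrob_design.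
under eq_integral do rewrite sqfrob_design.
rewrite (gaussian_square_mgf P X gaussX indX) ?uniq_design_keys//.
rewrite size_design_keys -EFinM lee_fin.
have s2 : Num.sqrt 2 <= expR 1 :> R.
  rewrite (@le_trans _ _ 2)//; last by have := expR_ge1Dx (1 : R); lra.
  by rewrite -[leRHS]ger0_norm// -sqrtr_sqr ler_sqrt//; lra.
apply: (@le_trans _ _ (expR (- ((1 + d%:R) * m%:R)) * expR 1 ^+ (m * d))).
  by rewrite ler_pM2l ?expR_gt0// lerXn2r ?nnegrE ?expR_ge0 ?sqrtr_ge0.
rewrite -expRM_natl -expRD ler_expR natrM mulr1.
by lra.
Qed.

End design_bounds.

(** * Ridge regression and grids *)

Section euclidean.
Context {R : realType}.

Definition dot {n} (u v : 'cV[R]_n) : R := \sum_(i < n) u i ord0 * v i ord0.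

Lemma dotE n (u v : 'cV[R]_n) : dot u v = (u^T *m v) ord0 ord0.
Proof. by rewrite mxE; apply: eq_bigr => i _; rewrite mxE. Qed.

Lemma dotC n (u v : 'cV[R]_n) : dot u v = dot v u.
Proof. by apply: eq_bigr => i _; rewrite mulrC. Qed.

Lemma dotDl n (u v w : 'cV[R]_n) : dot (u + v) w = dot u w + dot v w.
Proof. by rewrite -big_split; apply: eq_bigr => i _; rewrite mxE mulrDl. Qed.

Lemma dotZl n c (u v : 'cV[R]_n) : dot (c *: u) v = c * dot u v.
Proof. by rewrite mulr_sumr; apply: eq_bigr => i _; rewrite mxE mulrA. Qed.

Lemma dotDr n (u v w : 'cV[R]_n) : dot w (u + v) = dot w u + dot w v.
Proof. by rewrite dotC dotDl !(dotC _ w). Qed.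

Lemma dotZr n c (u v : 'cV[R]_n) : dot v (c *: u) = c * dot v u.
Proof. by rewrite dotC dotZl dotC. Qed.

Lemma dot_adj m n (A : 'M[R]_(m, n)) u v : dot (A^T *m u) v = dot u (A *m v).
Proof. by rewrite !dotE trmx_mul trmxK mulmxA. Qed.

Lemma sqnormE n (v : 'cV[R]_n) : sqnorm v = dot v v.
Proof. by apply: eq_bigr => i _; rewrite expr2. Qed.

Lemma sqnorm_ge0 n (v : 'cV[R]_n) : 0 <= sqnorm v.
Proof. by apply: sumr_ge0 => i _; exact: sqr_ge0. Qed.

Lemma sqnorm_eq0 n (v : 'cV[R]_n) : sqnorm v = 0 -> v = 0.
Proof.
move=> /eqP; rewrite psumr_eq0; last by move=> i _; exact: sqr_ge0.
move=> /allP v0; apply/colP => i; rewrite mxE.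
by have := v0 i (mem_index_enum i); rewrite implyTb sqrf_eq0 => /eqP.
Qed.

Lemma sqnormD n (u v : 'cV[R]_n) : sqnorm (u + v) = sqnorm u + 2 * dot u v + sqnorm v.
Proof. by rewrite !sqnormE !(dotDl, dotDr) (dotC _ v u); ring. Qed.

Lemma sqnormZ n c (v : 'cV[R]_n) : sqnorm (c *: v) = c ^+ 2 * sqnorm v.
Proof. by rewrite !sqnormE dotZl dotZr mulrA expr2. Qed.

Lemma dot0r n (v : 'cV[R]_n) : dot v 0 = 0.
Proof. by rewrite -(scale0r v) dotZr mul0r. Qed.

Lemma sqnorm0 n : sqnorm (0 : 'cV[R]_n) = 0.
Proof. by rewrite sqnormE dot0r. Qed.

Lemma sqnormB_le n (u v : 'cV[R]_n) : sqnorm u <= 2 * sqnorm v + 2 * sqnorm (u - v).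
Proof.
(* The difference of the two sides is exactly [|2 v - u|^2]. *)
have := sqnorm_ge0 _ (2 *: v + (-1) *: u).
rewrite -[- v]scaleN1r !sqnormD !sqnormZ !(dotZl, dotZr) (dotC _ v u).
by lra.
Qed.

Lemma cauchy_schwarz n (u v : 'cV[R]_n) : dot u v ^+ 2 <= sqnorm u * sqnorm v.
Proof.
have [/sqnorm_eq0 ->|v0] := eqVneq (sqnorm v) 0.
  by rewrite dot0r sqnorm0 mulr0 expr0n.
have vp : 0 < sqnorm v by rewrite lt_neqAle eq_sym v0 sqnorm_ge0.
rewrite -subr_ge0 -(pmulr_rge0 _ vp).
have := sqnorm_ge0 _ (sqnorm v *: u + - dot u v *: v).
rewrite sqnormD !sqnormZ dotZl dotZr; congr (0 <= _); ring.
Qed.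

Lemma norm2E n (v : 'cV[R]_n) : norm2 v = Num.sqrt (sqnorm v).
Proof. by []. Qed.

Lemma norm2_ge0 n (v : 'cV[R]_n) : 0 <= norm2 v.
Proof. exact: sqrtr_ge0. Qed.

Lemma sqr_norm2 n (v : 'cV[R]_n) : norm2 v ^+ 2 = sqnorm v.
Proof. by rewrite sqr_sqrtr// sqnorm_ge0. Qed.

Lemma norm2N n (v : 'cV[R]_n) : norm2 (- v) = norm2 v.
Proof. by rewrite !norm2E -scaleN1r sqnormZ sqrrN expr1n mul1r. Qed.

Lemma norm2D n (u v : 'cV[R]_n) : norm2 (u + v) <= norm2 u + norm2 v.
Proof.
rewrite -(ler_pXn2r (n := 2))// ?nnegrE ?addr_ge0 ?norm2_ge0//.
rewrite sqrrD !sqr_norm2 sqnormD -[norm2 u * _ *+ 2]mulr_natl.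
rewrite lerD2r lerD2l ler_pM2l//.
apply: (le_trans (ler_norm _)).
rewrite -(ler_pXn2r (n := 2))// ?nnegrE ?mulr_ge0 ?norm2_ge0//.
by rewrite exprMn !sqr_norm2 real_normK ?num_real// cauchy_schwarz.
Qed.

Lemma sqnorm_mulmx_le m n (A : 'M[R]_(m, n)) v :
  sqnorm (A *m v) <= sqfrob A * sqnorm v.
Proof.
rewrite /sqfrob mulr_suml; apply: ler_sum => i _.
have -> : (A *m v) i ord0 = dot (row i A)^T v.
  by rewrite mxE; apply: eq_bigr => j _; rewrite !mxE.
apply: (le_trans (cauchy_schwarz _ _ _)).
by rewrite /sqnorm; under eq_bigr do rewrite !mxE.
Qed.

Lemma ridge_dot m n (A : 'M[R]_(m, n)) (alpha : R) v :
  dot v ((1%:M + alpha *: (A^T *m A)) *m v) = sqnorm v + alpha * sqnorm (A *m v).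
Proof.
rewrite mulmxDl mul1mx -scalemxAl -mulmxA dotDr dotZr -sqnormE.
by rewrite (dotC _ v) dot_adj -sqnormE.
Qed.

(** A kernel vector [v] satisfies [|v|^2 + alpha |A v|^2 = 0] by [ridge_dot]. *)
Lemma ridge_unit m n (A : 'M[R]_(m, n)) (alpha : R) : 0 <= alpha ->
  1%:M + alpha *: (A^T *m A) \in unitmx.
Proof.
move=> al0; rewrite -unitmx_tr -row_free_unit; apply: inj_row_free => v vB.
have vBt : (1%:M + alpha *: (A^T *m A)) *m v^T = 0.
  by rewrite -[X in X *m _]trmxK -trmx_mul vB trmx0.
have := ridge_dot _ _ A alpha v^T; rewrite vBt.
rewrite dot0r => /esym/eqP.
rewrite paddr_eq0 ?sqnorm_ge0 ?mulr_ge0 ?sqnorm_ge0// => /andP[/eqP/sqnorm_eq0 v0 _].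
by rewrite -[v]trmxK v0 trmx0.
Qed.

Lemma norm2_le_sqr n k (u : 'cV[R]_n) (v : 'cV[R]_k) (c : R) : 0 <= c ->
  c ^+ 2 * sqnorm u <= sqnorm v -> c * norm2 u <= norm2 v.
Proof.
move=> c0 h; rewrite -(ler_pXn2r (n := 2))// ?nnegrE ?mulr_ge0 ?norm2_ge0//.
by rewrite exprMn !sqr_norm2.
Qed.

Lemma ridge_inv_le m n (A : 'M[R]_(m, n)) (alpha lam : R) (u : 'cV[R]_n) :
  0 <= alpha -> 0 <= lam ->
  (forall v, lam * sqnorm v <= alpha * sqnorm (A *m v)) ->
  (1 + lam) * norm2 u <= norm2 ((1%:M + alpha *: (A^T *m A)) *m u).
Proof.
move=> al0 l0 hl; apply: norm2_le_sqr; first by rewrite addr_ge0.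
set b := _ *m u.
(* Expanding [|b - (1 + lam) u|^2 >= 0] and using [u . b >= (1 + lam) |u|^2] bounds [|b|^2] from
   below. *)
have := sqnorm_ge0 _ (b + - (1 + lam) *: u).
rewrite sqnormD sqnormZ dotZr dotC ridge_dot.
have := hl u; have := sqnorm_ge0 _ u; nra.
Qed.

(** With [v = (I + M)^-1 e], the vector on the left is [M v] while [e = v + M v]; the cross term
    [v . M v] is nonnegative, so [|M v| <= |e|]. *)
Lemma ridge_shrink_le m n (A : 'M[R]_(m, n)) (alpha : R) (e : 'cV[R]_n) :
  0 <= alpha ->
  norm2 (invmx (1%:M + alpha *: (A^T *m A)) *m (alpha *: (A^T *m A) *m e)) <=
    norm2 e.
Proof.
move=> al0; set M := alpha *: _; have uM := ridge_unit _ _ A alpha al0; rewrite -/M in uM.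
set v := invmx (1%:M + M) *m e.
have ev : e = v + M *m v by rewrite -{1}(mul1mx v) -mulmxDl mulKVmx.
have -> : invmx (1%:M + M) *m (M *m e) = M *m v.
  rewrite [in LHS]ev mulmxDr.
  have -> : M *m v + M *m (M *m v) = (1%:M + M) *m (M *m v) by rewrite mulmxDl mul1mx.
  by rewrite mulKmx.
rewrite -[leLHS]mul1r; apply: norm2_le_sqr => //.
rewrite expr1n mul1r ev sqnormD.
have : 0 <= dot v (M *m v).
  rewrite /M -scalemxAl dotZr -mulmxA dotC dot_adj -sqnormE.
  by rewrite mulr_ge0 ?sqnorm_ge0.
by have := sqnorm_ge0 _ v; lra.
Qed.

Lemma ridge_step m n (A : 'M[R]_(m, n)) (alpha lam : R) (b e : 'cV[R]_n) :
  0 <= alpha -> 0 <= lam ->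
  (forall v, lam * sqnorm v <= alpha * sqnorm (A *m v)) ->
  norm2 (invmx (1%:M + alpha *: (A^T *m A)) *m (b + alpha *: (A^T *m A) *m e)) <=
    norm2 b / (1 + lam) + norm2 e.
Proof.
move=> al0 l0 hl; set M := alpha *: _; have uM := ridge_unit _ _ A alpha al0; rewrite -/M in uM.
rewrite mulmxDr; apply: (le_trans (norm2D _ _ _)).
apply: lerD; last exact: (ridge_shrink_le _ _ A alpha e al0).
rewrite ler_pdivlMr ?ltr_pwDl// mulrC.
apply: (le_trans (ridge_inv_le _ _ A alpha lam _ al0 l0 hl)).
by rewrite -/M mulKVmx.
Qed.

(** Holds because [x0 = (I + M)^-1 (x0 + M x0)]; the error thus obeys the same recursion with
    shifted data. *)
Lemma ridge_recenter m n (A : 'M[R]_(m, n)) (alpha : R) (x x0 y : 'cV[R]_n) :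
  0 <= alpha ->
  invmx (1%:M + alpha *: (A^T *m A)) *m (x + alpha *: (A^T *m A) *m y) - x0 =
  invmx (1%:M + alpha *: (A^T *m A)) *m
    ((x - x0) + alpha *: (A^T *m A) *m (y - x0)).
Proof.
move=> al0; set M := alpha *: _; have uM := ridge_unit _ _ A alpha al0; rewrite -/M in uM.
rewrite -[X in _ - X](mulKmx uM) -mulmxBr; congr (_ *m _).
by rewrite mulmxDl mul1mx mulmxBr opprD addrACA.
Qed.

(** * From grid points to all vectors *)

(** The grid of mesh [1 / N] in the cube [[-1, 1]^n], indexed by a finite type so that its points
    can be counted. *)
Definition gridpt (N n : nat) (f : {ffun 'I_n -> 'I_(2 * N).+1}) : 'cV[R]_n :=
  \col_j ((f j)%:R / N%:R - 1).

Lemma grid_approx (N n : nat) (v : 'cV[R]_n) : (0 < N)%N -> sqnorm v = 1 ->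
  exists f, sqnorm (v - gridpt N n f) <= n%:R / N%:R ^+ 2.
Proof.
move=> N0 v1; have Nr : 0 < N%:R :> R by rewrite ltr0n.
have vj j : -1 <= v j ord0 <= 1.
  rewrite -ler_norml -(ler_pXn2r (n := 2))// ?nnegrE//.
  rewrite expr1n real_normK ?num_real// -v1 /sqnorm (bigD1 j)//= lerDl.
  by apply: sumr_ge0 => i _; exact: sqr_ge0.
(* Each coordinate is rounded down to the grid, with error below [1 / N]; [|v_j| <= 1] keeps the
   index at most [2 N]. *)
pose k j := Num.truncn (N%:R * (v j ord0 + 1)).
have kB j : (k j)%:R <= N%:R * (v j ord0 + 1) < (k j).+1%:R.
  apply: truncn_itv; rewrite mulr_ge0 ?ler0n//.
  by have /andP[] := vj j; lra.
have kN j : (k j < (2 * N).+1)%N.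
  rewrite ltnS -(ler_nat R) natrM; have /andP[h _] := kB j.
  apply: (le_trans h); rewrite mulrC ler_pM2r//.
  by have /andP[_] := vj j; lra.
exists [ffun j => Ordinal (kN j)].
have -> : n%:R / N%:R ^+ 2 = \sum_(j < n) (N%:R ^-1) ^+ 2 :> R.
  by rewrite sumr_const card_ord exprVn -[RHS]mulr_natl.
apply: ler_sum => j _; rewrite !mxE ffunE /=.
have -> : v j ord0 - ((k j)%:R / N%:R - 1) =
    (N%:R * (v j ord0 + 1) - (k j)%:R) / N%:R by field; rewrite gt_eqF.
rewrite exprMn ler_piMl ?sqr_ge0//.
have /andP[h1] := kB j; rewrite -natr1 => h2.
by rewrite expr_le1// ?subr_ge0//; lra.
Qed.

(** For a unit vector [u] and a nearby grid point [g], [1 <= 2 |g|^2 + 1/2] gives [|g|^2 >= 1/4],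
    and [beta <= |A g|^2 <= 2 |A u|^2 + 2 (beta / 4)]. Homogeneity gives all [v]. *)
Lemma sqnorm_lower_of_grid (N m n : nat) (A : 'M[R]_(m, n)) (F beta : R) :
  (0 < N)%N -> 4 * n%:R <= N%:R ^+ 2 :> R -> 4 * F * n%:R <= beta * N%:R ^+ 2 ->
  sqfrob A <= F ->
  (forall f, 4^-1 <= sqnorm (gridpt N n f) -> beta <= sqnorm (A *m gridpt N n f)) ->
  forall v, beta / 4 * sqnorm v <= sqnorm (A *m v).
Proof.
move=> N0 hN hF AF hg v; have Nr : 0 < N%:R :> R by rewrite ltr0n.
have N2 : 0 < N%:R ^+ 2 :> R by rewrite exprn_gt0.
have unit_case u : sqnorm u = 1 -> beta / 4 <= sqnorm (A *m u).
  move=> u1; have [f fu] := grid_approx N n u N0 u1.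
  have nN : n%:R / N%:R ^+ 2 <= 4^-1 :> R by rewrite ler_pdivrMr//; lra.
  have FN : F * (n%:R / N%:R ^+ 2) <= beta / 4 by rewrite mulrA ler_pdivrMr//; lra.
  have gb : beta <= sqnorm (A *m gridpt N n f).
    apply: hg; have := sqnormB_le _ u (gridpt N n f); rewrite u1; lra.
  have := sqnormB_le _ (A *m gridpt N n f) (A *m u).
  rewrite -mulmxBr -opprB mulmxN -scaleN1r sqnormZ sqrrN expr1n mul1r.
  have := sqnorm_mulmx_le _ _ A (u - gridpt N n f).
  have : sqfrob A * sqnorm (u - gridpt N n f) <= F * (n%:R / N%:R ^+ 2).
    rewrite ler_pM ?sqnorm_ge0//.
    by apply: sumr_ge0 => i _; apply: sumr_ge0 => j _; exact: sqr_ge0.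
  by lra.
have [/sqnorm_eq0 ->|v0] := eqVneq (sqnorm v) 0.
  by rewrite mulmx0 !sqnorm0 mulr0.
have vp : 0 < sqnorm v by rewrite lt_neqAle eq_sym v0 sqnorm_ge0.
have := unit_case ((norm2 v)^-1 *: v).
rewrite -scalemxAr !sqnormZ exprVn sqr_norm2 mulVf// => /(_ erefl).
by move=> h; rewrite -ler_pdivlMr// [leRHS]mulrC.
Qed.

End euclidean.

(** * Measurability and summation *)

Lemma measurable_fun_inv {R : realType} {dT : measure_display}
  {T : measurableType dT} (f : T -> R) :
  measurable_fun setT f -> measurable_fun setT (fun w => (f w)^-1).
Proof.
move=> mf.
(* [powR_inv1] needs a nonnegative base, whence the square. *)
have -> : (fun w => (f w)^-1) = (fun w => f w * (f w ^+ 2) `^ (-1)).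
  apply/funext => w; rewrite powR_inv1 ?sqr_ge0//.
  have [->|f0] := eqVneq (f w) 0; first by rewrite invr0 mul0r.
  by field.
apply: measurable_funM => //.
apply: (@measurableT_comp _ _ _ _ _ _ (fun x : R => x `^ (-1)) _ (fun w => f w ^+ 2)).
  exact: measurable_powR.
exact: measurable_funX.
Qed.

Section measurable_matrices.
Context {R : realType} {dT : measure_display} {T : measurableType dT}.

Definition measurable_mx {m n} (A : T -> 'M[R]_(m, n)) :=
  forall i j, measurable_fun setT (fun w => A w i j).

Lemma measurable_mx_cst m n (A : 'M[R]_(m, n)) : measurable_mx (fun=> A).
Proof. by move=> i j; exact: measurable_cst. Qed.

Lemma measurable_mxD m n (A B : T -> 'M[R]_(m, n)) :
  measurable_mx A -> measurable_mx B -> measurable_mx (fun w => A w + B w).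
Proof.
move=> mA mB i j; under eq_fun do rewrite mxE.
exact: measurable_funD.
Qed.

Lemma measurable_mxZ m n (c : R) (A : T -> 'M[R]_(m, n)) :
  measurable_mx A -> measurable_mx (fun w => c *: A w).
Proof.
move=> mA i j; under eq_fun do rewrite mxE.
exact: measurable_funM.
Qed.

Lemma measurable_mx_tr m n (A : T -> 'M[R]_(m, n)) :
  measurable_mx A -> measurable_mx (fun w => (A w)^T).
Proof. by move=> mA i j; under eq_fun do rewrite mxE; exact: mA. Qed.

Lemma measurable_mxM m n p (A : T -> 'M[R]_(m, n)) (B : T -> 'M[R]_(n, p)) :
  measurable_mx A -> measurable_mx B -> measurable_mx (fun w => A w *m B w).
Proof.
move=> mA mB i j; under eq_fun do rewrite mxE.
by apply: measurable_sum => k; exact: measurable_funM.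
Qed.

Lemma measurable_det n (A : T -> 'M[R]_n) :
  measurable_mx A -> measurable_fun setT (fun w => \det (A w)).
Proof.
move=> mA; apply: measurable_sum => s; apply: measurable_funM => //.
by apply: measurable_prod.
Qed.

Lemma measurable_adj n (A : T -> 'M[R]_n) :
  measurable_mx A -> measurable_mx (fun w => \adj (A w)).
Proof.
move=> mA i j; under eq_fun do rewrite mxE.
apply: measurable_funM => //; apply: measurable_det => k l.
by under eq_fun do rewrite !mxE; exact: mA.
Qed.

Lemma measurable_invmx n (A : T -> 'M[R]_n) : (forall w, A w \in unitmx) ->
  measurable_mx A -> measurable_mx (fun w => invmx (A w)).
Proof.
move=> uA mA i j.
(* Invertibility everywhere selects one branch of [invmx], the adjugate over the determinant. *)
under eq_fun => w do rewrite /invmx uA mxE.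
apply: measurable_funM; last exact: measurable_adj.
by apply: measurable_fun_inv; exact: measurable_det.
Qed.

Lemma measurable_sqnorm n (v : T -> 'cV[R]_n) :
  measurable_mx v -> measurable_fun setT (fun w => sqnorm (v w)).
Proof. by move=> mv; apply: measurable_sum => i; apply: measurable_funX. Qed.

Lemma measurable_Emu (d : nat) (sbar sigma : R) (mubar mu0 : 'cV[R]_d)
  (m : nat -> nat) (X : idx -> T -> R) (t : nat) :
  (forall k, measurable_fun setT (X k)) ->
  measurable_mx (fun w => Emu sbar sigma mubar mu0 m X t w).
Proof.
move=> mX; elim: t => [|t IH] /=; first exact: measurable_mx_cst.
have mD : measurable_mx (fun w => design X t.+1 (m t.+1) d w).
  by move=> i j; under eq_fun do rewrite mxE; exact: mX.
have mM : measurable_mx (fun w => (sbar / sigma) ^+ 2 *: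
    ((design X t.+1 (m t.+1) d w)^T *m design X t.+1 (m t.+1) d w)).
  by apply: measurable_mxZ; apply: measurable_mxM => //; exact: measurable_mx_tr.
apply: measurable_mxM.
  apply: measurable_invmx; first by move=> w; apply: ridge_unit; exact: sqr_ge0.
  by apply: measurable_mxD => //; exact: measurable_mx_cst.
apply: measurable_mxD; first exact: measurable_mx_cst.
exact: measurable_mxM.
Qed.

Lemma norm2_le_sqnorm n (v : 'cV[R]_n) (r : R) : 0 <= r ->
  (norm2 v <= r) = (sqnorm v <= r ^+ 2).
Proof. by move=> r0; rewrite -sqr_norm2 ler_pXn2r// nnegrE norm2_ge0. Qed.

(** A countable intersection over [t] of events on squared norms, which are rational in the design
    entries. *)
Lemma measurable_Emu_close (d : nat) (sbar sigma delta : R) (mubar mu0 : 'cV[R]_d)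
  (m : nat -> nat) (X : idx -> T -> R) :
  (forall k, measurable_fun setT (X k)) -> 0 <= delta ->
  measurable [set w | forall t : nat,
    norm2 (Emu sbar sigma mubar mu0 m X t w - mu0) <= delta].
Proof.
move=> mX d0.
rewrite (_ : [set w | _] = \bigcap_t [set w |
    sqnorm (Emu sbar sigma mubar mu0 m X t w - mu0) <= delta ^+ 2]); last first.
  apply/seteqP; split=> w /= h t; first by move=> _ /=; rewrite -norm2_le_sqnorm.
  by rewrite norm2_le_sqnorm//; exact: h.
apply: bigcapT_measurable => t.
rewrite -[X in measurable X]setTI; apply: measurable_fun_ler => //.
apply: measurable_sqnorm; apply: measurable_mxD.
  exact: measurable_Emu.
exact: measurable_mx_cst.
Qed.

Lemma measure_bigcup_seq_le (P : probability T R) (I : choiceType) (s : seq I)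
  (F : I -> set T) (b : R) :
  (forall i, measurable (F i)) -> (forall i, (P (F i) <= b%:E)%E) ->
  (P (\bigcup_(i in [set` s]) F i) <= ((size s)%:R * b)%:E)%E.
Proof.
move=> mF Fb; rewrite bigcup_seq; elim: s => [|i s IH].
  by rewrite big_nil measure0 mul0r.
rewrite big_cons /= -natr1 mulrDl mul1r addrC EFinD.
have mU : measurable (\big[setU/set0]_(j <- s) F j).
  by rewrite -bigcup_seq; apply: fin_bigcup_measurable.
exact: (le_trans (measureU2 P (mF i) mU) (leeD (Fb i) IH)).
Qed.

Lemma measure_bigcup_le (P : probability T R) (F : nat -> set T) (u : nat -> R)
  (M : R) :
  (forall n, measurable (F n)) -> (forall n, 0 <= u n) ->
  (forall n, (P (F n) <= (u n)%:E)%E) ->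
  (forall n, \sum_(k < n) u k <= M) ->
  (P (\bigcup_n F n) <= M%:E)%E.
Proof.
move=> mF u0 Fu uM.
apply: (le_trans (measure_sigma_subadditive P mF _ (@subset_refl _ _))).
  exact: bigcupT_measurable.
apply: (@le_trans _ _ (\sum_(n <oo) (u n)%:E)%E).
  by apply: lee_nneseries => // n _; exact: Fu.
apply: lime_le.
  by apply: is_cvg_nneseries => n _ _; rewrite lee_fin.
by apply: nearW => n; rewrite sumEFin lee_fin big_mkord.
Qed.

End measurable_matrices.

(** * Two convergent series *)

(** Telescoping: [(k + 2)^-2 <= 1 / (k + 1) - 1 / (k + 2)]. *)
Lemma sum_inv_sqr_le {R : realType} (n : nat) :
  \sum_(k < n) (k%:R + 2) ^- 2 <= 1 - (n%:R + 1)^-1 :> R.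
Proof.
elim: n => [|n IH]; first by rewrite big_ord0 add0r invr1 subrr.
rewrite big_ord_recr /=; apply: (le_trans (lerD IH (lexx _))).
have n0 : 0 <= n%:R :> R by [].
rewrite -[n.+1%:R]natr1; set x : R := n%:R in n0 *.
have xx : (x + 1)^-1 - (x + 1 + 1)^-1 = ((x + 1) * (x + 2))^-1.
  by field; apply/andP; split; rewrite gt_eqF//; lra.
have : (x + 2) ^- 2 <= ((x + 1) * (x + 2))^-1.
  have x1 : 0 < x + 1 by lra.
  have x2 : 0 < x + 2 by lra.
  by rewrite lef_pV2 ?posrE ?exprn_gt0 ?mulr_gt0// expr2 ler_pM2r//; lra.
by rewrite -xx; lra.
Qed.

(** Factor out [(x + 1)^-c]; the quotient is [exp (c (ln (x + 1) - ln x)) >= 1 + c / (x + 1)], by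
    [ln (1 + y) <= y] at [y = - 1 / (x + 1)] and [exp z >= 1 + z]. *)
Lemma powR_telescope {R : realType} (c x : R) : 0 < c -> 0 < x ->
  c * ((x + 1) `^ (1 + c))^-1 <= x `^ (- c) - (x + 1) `^ (- c).
Proof.
move=> c0 x0; have y0 : 0 < x + 1 by rewrite addr_gt0.
pose z := (x + 1) `^ (- c); have z0 : 0 < z by exact: powR_gt0.
have -> : ((x + 1) `^ (1 + c))^-1 = (x + 1)^-1 * z.
  rewrite powRD; last by rewrite (gt_eqF y0) implybT.
  by rewrite powRr1 ?(ltW y0)// invfM /z powRN.
have -> : x `^ (- c) = z * expR (c * (ln (x + 1) - ln x)).
  by rewrite /z /powR !gt_eqF// -expRD; congr expR; ring.
rewrite -[(x + 1) `^ (- c)]/z.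
have h : (x + 1)^-1 <= ln (x + 1) - ln x.
  have xy : 1 + - (x + 1)^-1 = x / (x + 1) by field; rewrite gt_eqF.
  have : ln (1 + - (x + 1)^-1) <= - (x + 1)^-1.
    by apply: le_ln1Dx; rewrite ltrN2 invf_lt1//; lra.
  rewrite xy ln_div ?posrE//; lra.
have := expR_ge1Dx (c * (ln (x + 1) - ln x)).
have : c * (x + 1)^-1 <= c * (ln (x + 1) - ln x) by rewrite ler_pM2l.
set E := expR _; set l := c * (ln _ - _) => h1 h2.
have : z * (c * (x + 1)^-1) <= z * (E - 1) by rewrite ler_pM2l//; lra.
by lra.
Qed.

Lemma sum_riemannR_le {R : realType} (c : R) (n : nat) : 0 < c ->
  \sum_(s < n) ((s.+1)%:R `^ (1 + c))^-1 <= 1 + c^-1 :> R.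
Proof.
move=> c0; case: n => [|n].
  by rewrite big_ord0 addr_ge0// invr_ge0 ltW.
(* The sharper bound keeps the telescoping remainder for the induction. The first term, 1, stands
   apart because [powR_telescope] needs [x > 0]. *)
apply: (@le_trans _ _ (1 + c^-1 * (1 - (n.+1)%:R `^ (- c)))); last first.
  rewrite lerD2l ler_piMr ?invr_ge0 ?(ltW c0)// lerBlDr lerDl.
elim: n => [|n IH].
  by rewrite big_ord_recr big_ord0 /= !powR1 invr1 add0r subrr mulr0 addr0.
rewrite big_ord_recr /=; apply: (le_trans (lerD IH (lexx _))).
have := powR_telescope c (n.+1)%:R c0 (ltr0Sn _ _).
rewrite natr1 -ler_pdivlMl//.
by move: (_ `^ (- c)) (_ `^ (- c)) (_^-1) (c^-1) => u v r k; lra.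
Qed.

(** * Lower bound for one design, uniform in the vector *)

Lemma gaussian_design_lower {R : realType} (d : nat) : (0 < d)%N ->
  exists2 C : nat, (0 < C)%N &
  forall (dT : measure_display) (T : measurableType dT) (P : probability T R)
    (X : idx -> T -> R),
  (forall k, std_normal_rv P (X k)) -> mutually_independent P X ->
  forall t m : nat, exists B : set T,
  [/\ measurable B, (P B <= (C%:R * expR (- m%:R))%:E)%E &
    forall w, ~ B w -> forall v : 'cV[R]_d,
      m%:R / (2 * expR 4) / 4 * sqnorm v <= sqnorm (design X t m d w *m v)].
Proof.
move=> d0.
(* With [F = (4 + 4 d) m] and [beta = m / (2 e^4)], the grid condition [4 F d <= beta N^2] reads
   [b <= N^2], in which [m] has cancelled; [b < N <= N^2] for the next [N]. *)
pose b : R := 8 * expR 4 * (4 + 4 * d%:R) * d%:R.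
pose N := (Num.truncn b).+1.
have d1 : 1 <= d%:R :> R by rewrite ler1n.
have e1 : 1 <= expR 4 :> R by have := expR_ge1Dx (4 : R); lra.
have b0 : 0 <= b by rewrite /b !mulr_ge0 ?expR_ge0//; lra.
have bN : b <= N%:R ^+ 2.
  have := truncn_itv b0; rewrite -/N => /andP[_ bN].
  apply: (le_trans (ltW bN)); rewrite expr2 ler_peMl//.
  by rewrite ler1n.
have dN : 4 * d%:R <= N%:R ^+ 2 :> R.
  apply: le_trans bN; rewrite /b ler_wpM2r//.
  have : 1 * 1 <= expR 4 * (4 + 4 * d%:R) :> R by rewrite ler_pM//; lra.
  by lra.
pose fT := {ffun 'I_d -> 'I_(2 * N).+1}.
(* One bad event per grid point, plus one for a large Frobenius norm. *)
exists #|fT|.+1 => // dT T P X gX iX t m.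
have mX k : measurable_fun setT (X k) by case: (gX k).
(* The tail bound requires [|g|^2 >= 1/4]; shorter grid points get the empty event. *)
pose F (f : fT) : set T :=
  if 4^-1 <= sqnorm (gridpt (R := R) N d f) then
    [set w | sqnorm (design X t m d w *m gridpt N d f) <= m%:R / (2 * expR 4)]
  else set0.
pose G := [set w | (4 + 4 * d%:R) * m%:R <= sqfrob (design X t m d w)].
have mF f : measurable (F f).
  rewrite /F; case: ifP => _; last exact: measurable0.
  rewrite -[X in measurable X]setTI; apply: measurable_fun_ler => //.
  exact: measurable_sqnorm_design gX _ _ _ _.
have mG : measurable G.
  rewrite -[X in measurable X]setTI; apply: measurable_fun_ler => //.
  exact: measurable_sqfrob_design gX _ _ _.
have mU : measurable (\bigcup_(f in [set` enum fT]) F f).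
  by apply: fin_bigcup_measurable.
exists (G `|` \bigcup_(f in [set` enum fT]) F f); split.
- exact: measurableU.
- apply: (le_trans (measureU2 P mG mU)).
  have -> : #|fT|.+1%:R * expR (- m%:R) =
      expR (- m%:R) + #|fT|%:R * expR (- m%:R) :> R by rewrite mulrS mulrDl mul1r.
  rewrite EFinD; apply: leeD; first exact: (sqfrob_design_large P X gX iX).
  rewrite cardT; apply: measure_bigcup_seq_le => // f.
  rewrite /F; case: ifP => [g4|_]; last by rewrite measure0 lee_fin expR_ge0.
  exact: (sqnorm_design_small P X gX iX).
- move=> w /not_orP[nG nU].
  apply: (sqnorm_lower_of_grid N m d _ ((4 + 4 * d%:R) * m%:R)) => //.
  + apply: (@le_trans _ _ (m%:R / (2 * expR 4) * b)).
      rewrite /b le_eqVlt; apply/orP; left; apply/eqP.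
      by field; rewrite gt_eqF ?expR_gt0.
    by rewrite ler_wpM2l// divr_ge0// mulr_ge0 ?expR_ge0.
  + by move/negP : nG; rewrite -ltNge => /ltW.
  + move=> f g4; apply/ltW; rewrite ltNge; apply/negP => h.
    by apply: nU; exists f; rewrite /= ?mem_enum// /F g4.
Qed.

(** * Accumulated error and conclusion *)

Lemma norm2_Emu_le {R : realType} {dT : measure_display} {T : measurableType dT}
  (d : nat) (sbar sigma : R) (mubar mu0 : 'cV[R]_d) (m : nat -> nat)
  (X : idx -> T -> R) (lam : nat -> R) (w : T) :
  (forall s, 0 <= lam s) ->
  (forall s v, lam s * sqnorm v <=
    (sbar / sigma) ^+ 2 * sqnorm (design X s.+1 (m s.+1) d w *m v)) ->
  forall t, norm2 (Emu sbar sigma mubar mu0 m X t w - mu0) <=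
    \sum_(s < t) norm2 (mubar - mu0) / (1 + lam s).
Proof.
move=> l0 hl; elim=> [|t IH] /=.
  by rewrite subrr big_ord0 norm2E sqnorm0 sqrtr0.
rewrite ridge_recenter ?sqr_ge0// big_ord_recr /= addrC.
apply: (le_trans (ridge_step _ _ _ _ (lam t) _ _ _ _ _)) => //.
  exact: sqr_ge0.
by rewrite lerD2l.
Qed.

Lemma sample_size_ge {R : realType} (Dc c delta eps sbar sigma : R) (d : nat)
  (dist : R) (t : nat) :
  Dc * dist / delta * (sigma / sbar) ^+ 2 * powR (t%:R) (1 + c)
    + Dc * d%:R * ln ((t%:R + 1) / eps) <=
  (sample_size Dc c delta eps sbar sigma d dist t)%:R.
Proof.
rewrite /sample_size natr_absz; apply: (le_trans (ceil_ge _)).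
by rewrite ler_int ler_norm.
Qed.

Theorem theorem5 (R : realType) (c : R) (hc : 0 < c) :
  exists Dc : R, 0 < Dc /\
  forall (d : nat) (sbar sigma : R) (mubar mu0 : 'cV[R]_d),
    (0 < d)%N -> 0 < sbar -> 0 < sigma ->
  exists delta0 eps0 : R, 0 < delta0 /\ 0 < eps0 /\
  forall delta eps : R, 0 < delta -> delta < delta0 -> 0 < eps -> eps < eps0 ->
  forall (dT : measure_display) (T : measurableType dT) (P : probability T R)
         (X : idx -> T -> R),
    (forall k, std_normal_rv P (X k)) ->
    mutually_independent P X ->
    let m := sample_size Dc c delta eps sbar sigma d (norm2 (mu0 - mubar)) in
    let E := [set w | forall t : nat,
                norm2 (Emu sbar sigma mubar mu0 m X t w - mu0) <= delta] in
    measurable E /\ (P E > (1 - eps)%:E)%E.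
Proof.
(* [K] bounds the series of [t^-(1+c)], and [kappa] is the constant of [gaussian_design_lower]. *)
pose K : R := 1 + c^-1; pose kappa : R := (2 * expR 4)^-1 / 4.
have K0 : 0 < K by rewrite addr_gt0// invr_gt0.
have kappa0 : 0 < kappa by rewrite divr_gt0// invr_gt0 mulr_gt0 ?expR_gt0.
(* The first summand gives [kappa Dc >= K] for the error sum, the second [Dc >= 2] for
   square-summable failure probabilities. *)
pose Dc := K / kappa + 2.
have Kk0 : 0 < K / kappa by rewrite divr_gt0.
have Dc0 : 0 < Dc by rewrite addr_gt0.
have Dc2 : 2 <= Dc by rewrite /Dc lerDr ltW.
have DcK : K <= kappa * Dc.
  by rewrite /Dc mulrDr mulrCA divff ?gt_eqF// mulr1 lerDl mulr_ge0// ltW.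
exists Dc; split=> // d sbar sigma mubar mu0 d0 sb0 si0.
have [C C0 HC] := @gaussian_design_lower R d d0.
have C1 : 1 <= C%:R :> R by rewrite ler1n.
(* [eps < 1 / C] turns the total failure bound [C eps^2] into less than [eps]. *)
exists 1, (C%:R^-1); split=> //; split; first by rewrite invr_gt0; lra.
move=> delta eps de0 _ ep0 epC dT T P X gX iX m E.
have mX k : measurable_fun setT (X k) by case: (gX k).
have mE : measurable E by apply: measurable_Emu_close => //; exact: ltW.
split=> //.
have Ceps : C%:R * eps < 1 by rewrite mulrC -ltr_pdivlMr ?mul1r//; lra.
have eps1 : eps <= 1 by nra.
set dist := norm2 (mu0 - mubar) in m E mE *.
have dist0 : 0 <= dist by exact: norm2_ge0.
have distE : norm2 (mubar - mu0) = dist by rewrite -opprB norm2N.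
have ratio0 : 0 < sbar / sigma by rewrite divr_gt0.
pose first_term s : R := Dc * dist / delta * (sigma / sbar) ^+ 2 * (s.+1%:R `^ (1 + c)).
pose second_term s : R := Dc * d%:R * ln ((s.+1%:R + 1) / eps).
have m_ge s : first_term s + second_term s <= (m s.+1)%:R by exact: sample_size_ge.
have first0 s : 0 <= first_term s.
  by rewrite /first_term !mulr_ge0 ?powR_ge0 ?invr_ge0 ?(ltW Dc0) ?(ltW de0) ?(ltW sb0) ?(ltW si0).
have q1 s : 1 <= (s.+1%:R + 1) / eps.
  by rewrite ler_pdivlMr// mul1r (le_trans eps1)// lerDr.
have lnq0 s : 0 <= ln ((s.+1%:R + 1) / eps) by exact: ln_ge0.
have second2 s : 2 * ln ((s.+1%:R + 1) / eps) <= second_term s.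
  by rewrite ler_wpM2r// (le_trans Dc2)// ler_peMr ?(ltW Dc0)// ler1n.
have [B HB] := choice (fun s => HC dT T P X gX iX s.+1 (m s.+1)).
(* The index [s] stands for learner [s.+1], so the logarithmic term [ln ((t + 1) / eps)] contributes
   [(eps / (s + 2))^2]. *)
pose u s : R := C%:R * eps ^+ 2 * (s%:R + 2) ^- 2.
have u0 s : 0 <= u s.
  by rewrite mulr_ge0 ?invr_ge0 ?sqr_ge0// mulr_ge0 ?sqr_ge0.
have PB : (P (\bigcup_s B s) <= (C%:R * eps ^+ 2)%:E)%E.
  apply: (measure_bigcup_le P B u) => //.
  - by move=> s; have [] := HB s.
  - move=> s; have [_ PBs _] := HB s; apply: (le_trans PBs).
    rewrite lee_fin /u -mulrA ler_wpM2l//.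
    have s2 : s.+1%:R + 1 = s%:R + 2 :> R by rewrite -natr1; ring.
    apply: (@le_trans _ _ (expR (- (2 * ln ((s.+1%:R + 1) / eps))))).
      rewrite ler_expR lerN2 (le_trans (second2 s))// (le_trans _ (m_ge s))//.
      by rewrite lerDr.
    rewrite expRN (expRM_natl 2) lnK ?posrE; last first.
      by rewrite (lt_le_trans _ (q1 s)).
    by rewrite s2 exprMn exprVn invfM invrK mulrC.
  - move=> n; have M0 : 0 <= C%:R * eps ^+ 2 by rewrite mulr_ge0 ?sqr_ge0.
    rewrite /u -mulr_sumr ler_piMr//.
    by rewrite (le_trans (sum_inv_sqr_le n))// lerBlDr lerDl invr_ge0 addr_ge0.
have mB : measurable (\bigcup_s B s).
  by apply: bigcupT_measurable => s; have [] := HB s.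
have BE : ~` (\bigcup_s B s) `<=` E.
  move=> w nB t.
  pose lam s := (sbar / sigma) ^+ 2 * (kappa * (m s.+1)%:R).
  (* The factor [(sigma / sbar)^2] of the sample size cancels the scale of [M_t]. *)
  have lam_ge s : K * dist / delta * (s.+1%:R `^ (1 + c)) <= lam s.
    apply: (@le_trans _ _ ((sbar / sigma) ^+ 2 * (kappa * first_term s))).
      have -> : (sbar / sigma) ^+ 2 * (kappa * first_term s) =
          (kappa * Dc) * (dist / delta * (s.+1%:R `^ (1 + c))).
        by rewrite /first_term; field; rewrite !gt_eqF.
      rewrite (_ : K * dist / delta * _ = K * (dist / delta * (s.+1%:R `^ (1 + c)))).
        by rewrite ler_wpM2r// mulr_ge0 ?powR_ge0// divr_ge0// ltW.
      by rewrite !mulrA.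
    rewrite ler_wpM2l ?sqr_ge0// ler_wpM2l ?(ltW kappa0)//.
    rewrite (le_trans _ (m_ge s))// lerDl (le_trans _ (second2 s))//.
    by rewrite mulr_ge0.
  have lam0 s : 0 <= lam s.
    by rewrite mulr_ge0 ?sqr_ge0// mulr_ge0// ltW.
  apply: (le_trans (norm2_Emu_le d sbar sigma mubar mu0 m X lam w lam0 _ t)).
    move=> s v; rewrite /lam -mulrA ler_wpM2l ?sqr_ge0//.
    have [_ _ /(_ w)] := HB s.
    have nBs : ~ B s w by move=> Bs; apply: nB; exists s.
    by move=> /(_ nBs v); rewrite /kappa [_ * (m s.+1)%:R]mulrC mulrA.
  rewrite distE.
  apply: (@le_trans _ _ (\sum_(s < t) delta / K * ((s.+1)%:R `^ (1 + c))^-1)).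
    apply: ler_sum => s _.
    have y0 : 0 < (s.+1)%:R `^ (1 + c) :> R by rewrite powR_gt0.
    rewrite ler_pdivrMr; last by rewrite ltr_pwDl.
    have := lam_ge s; move: y0; set y := _ `^ _ => y0 h.
    have yK : 0 < delta / K * y^-1 by rewrite !mulr_gt0 ?invr_gt0.
    (* Factored so as to avoid dividing by [dist], which may vanish. *)
    have -> : dist = delta / K * y^-1 * (K * dist / delta * y).
      by field; rewrite !gt_eqF.
    by rewrite ler_pM2l// (le_trans h)// lerDr.
  rewrite -mulr_sumr -mulrA ler_piMr ?(ltW de0)// ler_pdivrMl// mulr1.
  exact: sum_riemannR_le.
(* It remains to see that the good event has probability at least [1 - C eps^2 > 1 - eps]. *)
apply: (@lt_le_trans _ _ (P (~` \bigcup_s B s))); last first.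
  by apply: le_measure => //; rewrite inE//; exact: measurableC.
rewrite probability_setC//.
have -> : P (\bigcup_s B s) = (fine (P (\bigcup_s B s)))%:E.
  by rewrite fineK// fin_num_measure.
have : fine (P (\bigcup_s B s)) <= C%:R * eps ^+ 2.
  by rewrite -lee_fin fineK// fin_num_measure.
rewrite -EFinB lte_fin expr2 mulrA => h.
have : C%:R * eps * eps < 1 * eps by rewrite ltr_pM2r.
by lra.
Qed.
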